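(* For all integers $n\ge 0$, $\alpha\ge 1$ and $\beta\ge 0$, $$\overline{B}_{2^{\alpha}}(2^{\alpha}(n+1)) \equiv 0\pmod{2^3}$$ and $$\overline{B}_{2^{\alpha}}(2^{\alpha+\beta+1}(n+1)) \equiv 0\pmod{2^{3\beta+5}}.$$
   Context: For an integer $k\ge 2$, $\overline{B}_k(n)$ denotes the number of $k$-regular overpartition pairs of $n$ (pairs of overpartitions with no part divisible by $k$ and with total sum of parts $n$; an overpartition is a partition in which the last occurrence of each part size may be overlined). Its generating function, as a formal power series in $q$, is $$\sum_{n=0}^{\infty} \overline{B}_{k}(n) q^n =\frac{(-q;q)^2_\infty\,(q^k;q^k)^2_\infty}{(q;q)^2_\infty\, (-q^k;q^k)^2_\infty},$$ where $(x;q)_\infty=\prod_{i=0}^\infty(1-xq^i)$. *)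

(* Defs.v *)
From HB Require Import structures.
From mathcomp Require Import all_boot.

Set Implicit Arguments.
Unset Strict Implicit.
Unset Printing Implicit Defensive.

(* An overpartition is the sequence of its parts in nonincreasing order, each
   part tagged with a flag telling whether it is overlined. *)

(* [pairwise] compares each entry with all later ones, so its condition says
   that an overlined part is the last occurrence of its size. *)
Definition is_overpartition (s : seq (nat * bool)) : bool :=
  [&& sorted geq [seq x.1 | x <- s],
      all (fun x => 0 < x.1) s
    & pairwise (fun x y => x.2 ==> (x.1 != y.1)) s].

Definition weight (s : seq (nat * bool)) : nat := \sum_(x <- s) x.1.

Definition regular (k : nat) (s : seq (nat * bool)) : bool :=
  all (fun x => ~~ (k %| x.1)) s.

Definition regular_overpartition_pair (k n : nat)
    (p : seq (nat * bool) * seq (nat * bool)) : bool :=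
  [&& is_overpartition p.1, is_overpartition p.2,
      regular k p.1, regular k p.2
    & weight p.1 + weight p.2 == n].

(* The parts of an overpartition of weight at most n are at most n in number
   and in size, so such overpartitions all arise from this finite type. *)
Definition bounded_seq (n : nat) := n.-bseq ('I_n.+1 * bool)%type.

Definition seq_of_bounded (n : nat) (s : bounded_seq n) : seq (nat * bool) :=
  [seq (nat_of_ord x.1, x.2) | x <- s].

Definition Bbar (k n : nat) : nat :=
  #|[pred p : bounded_seq n * bounded_seq n |
      regular_overpartition_pair k n
        (seq_of_bounded p.1, seq_of_bounded p.2)]|.

Lemma seq_of_bounded_inj n : injective (@seq_of_bounded n).
Proof.
move=> s t /inj_map st; apply/val_inj/st => -[i a] [j b] /= [/val_inj -> ->] //.
Qed.

Lemma seq_of_bounded_surj n s :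
  is_overpartition s -> weight s <= n -> exists t, @seq_of_bounded n t = s.
Proof.
rewrite /weight; case/and3P=> _ s_gt0 _ le_sn.
have le_part x : x \in s -> x.1 < n.+1.
  by move=> xs; rewrite ltnS (leq_trans _ le_sn) // (big_rem x) //= leq_addr.
have size_s : size s <= n.
  apply: leq_trans le_sn; elim: s s_gt0 {le_part} => //= x s IH /andP[x0 /IH].
  by rewrite big_cons -add1n; apply: leq_add.
pose t := [seq (inord x.1 : 'I_n.+1, x.2) | x <- s].
have size_t : size t <= n by rewrite size_map.
exists (Bseq size_t); rewrite /seq_of_bounded /= -map_comp -[RHS]map_id.
by apply/eq_in_map => -[i a] xs /=; rewrite inordK //; apply: (le_part _ xs).
Qed.

(* The bounds in [Bbar] lose nothing: it is the length of any duplicate-free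
   list of all k-regular overpartition pairs of n. *)
Lemma Bbar_enum k n (l : seq (seq (nat * bool) * seq (nat * bool))) :
  uniq l -> (forall p, (p \in l) = regular_overpartition_pair k n p) ->
  Bbar k n = size l.
Proof.
move=> l_uniq lP; rewrite /Bbar cardE.
set e := enum _; pose f (p : bounded_seq n * bounded_seq n) :=
  (seq_of_bounded p.1, seq_of_bounded p.2).
have f_inj : injective f.
  by move=> [a b] [c d] [/seq_of_bounded_inj -> /seq_of_bounded_inj ->].
rewrite -(size_map f); apply/perm_size/uniq_perm => //.
  by rewrite map_inj_uniq // enum_uniq.
move=> p; rewrite lP; apply/mapP/idP => [[q]|pP].
  by rewrite mem_enum inE => qP ->.
have /and5P[p1 p2 _ _ /eqP wp] := pP.
have [t1 E1] := @seq_of_bounded_surj n _ p1 ltac:(by rewrite -wp leq_addr).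
have [t2 E2] := @seq_of_bounded_surj n _ p2 ltac:(by rewrite -wp leq_addl).
exists (t1, t2); last by rewrite /f /= E1 E2; case: (p).
by rewrite mem_enum inE /= E1 E2; case: (p) pP.
Qed.

(* Main.v *)
From HB Require Import structures.
From mathcomp Require Import all_boot all_algebra.
From mathcomp Require Import boolp ring zify.
Require Import Defs.

Set Implicit Arguments.
Unset Strict Implicit.
Unset Printing Implicit Defensive.

Import GRing.Theory.

(** Write [O_k] for the generating function of the [k]-regular overpartitions,
    so that [Bbar k n] is the coefficient of [q ^ n] in [O_k ^ 2], and let
    [tau = O_2 ^ 2].  Since a part not divisible by [2 * k] is either odd or
    twice a part not divisible by [k], one has
    [O_2k (q) = O_2 (q) * O_k (q ^ 2)] ([ovgf_double]), so the series attached
    to [2 ^ a] is the product of the [tau (q ^ (2 ^ i))] for [i < a].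

    The finite form of the Jacobi triple product gives
    [tau = theta (q) / theta (- q)] ([theta_ratio]), where [theta] is the sum of
    [q ^ (x ^ 2)] over all integers [x].  Because [(x, y) -> (x + y, x - y)]
    doubles the norm [x ^ 2 + y ^ 2], the operator [U] that keeps the
    coefficients of even index fixes [theta ^ 2] ([psU_theta2]), and
    [theta (q) * theta (- q) = theta (- q ^ 2) ^ 2] ([theta_psN_theta]).  In
    terms of [tau] this says that [tau] is a root of
    [X ^ 2 - 2 * tau (q ^ 2) ^ 2 * X + 1] ([tau_quadratic]) and that
    [U tau = tau ^ 2] ([psU_tau]).  So [U (tau ^ n)] satisfies the recurrence
    of the Chebyshev polynomials in [tau ^ 2] ([psU_tau_exp]); applying [U] to
    the product above [a] times removes its factors one by one and leaves an
    element of [Z[tau ^ 2]] ([ovgf_pow2_descent]).  As [tau ^ 2] is 1 modulo 8, such an element is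
    constant modulo 8 ([ztau2_mod8]), which is the first congruence.

    For the second one, write [tau ^ 4 = 1 + 16 * v] and [w = v + 16 * v ^ 2].
    Then [U v = 8 * w], and [v] is a root of [X ^ 2 - 16 * w' * X - w'] with
    [w' = w (q ^ 2)] ([v_quadratic]), so the powers of [v] satisfy a two-term
    recurrence under [U].  Let [L = v * Z[8 * v]].  This recurrence shows that
    [U] maps [L] into [8 * L] ([lattice_psU]), while the Chebyshev recurrence
    shows that [U] maps [Z[tau ^ 2]] into [Z + 32 * L] ([ztau2_lattice]).  Hence
    [a + beta + 1] applications of [U] lead into
    [Z + 2 ^ (3 * beta + 5) * L]. *)

(** * Formal power series *)

(** A wrapper, since functions into a ring may carry the pointwise product. *)
Record powser (R : Type) := PowSer { coefs : nat -> R }.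

HB.instance Definition _ (R : Type) := gen_eqMixin (powser R).
HB.instance Definition _ (R : Type) := gen_choiceMixin (powser R).

Section PowSer.
Variable R : comNzRingType.
Implicit Types f g h : powser R.
Local Open Scope ring_scope.

Lemma powserP f g : coefs f =1 coefs g -> f = g.
Proof. by case: f g => [f] [g] /= /funext ->. Qed.

Definition ps_zero : powser R := PowSer (fun=> 0).
Definition ps_one : powser R := PowSer (fun n => (n == 0)%:R).
Definition ps_opp f : powser R := PowSer (fun n => - coefs f n).
Definition ps_add f g : powser R := PowSer (fun n => coefs f n + coefs g n).
Definition ps_mul f g : powser R :=
  PowSer (fun n => \sum_(i < n.+1) coefs f i * coefs g (n - i)).

Lemma ps_addA : associative ps_add.
Proof. by move=> f g h; apply/powserP=> n /=; rewrite addrA. Qed.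
Lemma ps_addC : commutative ps_add.
Proof. by move=> f g; apply/powserP=> n /=; rewrite addrC. Qed.
Lemma ps_add0 : left_id ps_zero ps_add.
Proof. by move=> f; apply/powserP=> n /=; rewrite add0r. Qed.
Lemma ps_addN : left_inverse ps_zero ps_opp ps_add.
Proof. by move=> f; apply/powserP=> n /=; rewrite addNr. Qed.

HB.instance Definition _ :=
  GRing.isZmodule.Build (powser R) ps_addA ps_addC ps_add0 ps_addN.

Definition trunc n f : {poly R} := \poly_(i < n) coefs f i.

(** Products of power series are computed by truncation to polynomials, so the
    ring axioms can be read off from those of polynomials. *)
Lemma coef_ps_mul m n f g : (n < m)%N ->
  coefs (ps_mul f g) n = (trunc m f * trunc m g)`_n.
Proof.
move=> nm; rewrite coefM; apply: eq_bigr => i _; rewrite !coef_poly.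
by rewrite !ifT //; apply: leq_ltn_trans nm; rewrite ?leq_subr // -ltnS.
Qed.

Lemma ps_mulC : commutative ps_mul.
Proof.
by move=> f g; apply/powserP=> n; rewrite !(@coef_ps_mul n.+1) // mulrC.
Qed.

Lemma coef_mul_trunc m n f (p : {poly R}) : (n < m)%N ->
  (trunc m f * p)`_n = \sum_(i < n.+1) coefs f i * p`_(n - i).
Proof.
move=> nm; rewrite coefM; apply: eq_bigr => i _.
by rewrite coef_poly ifT //; apply: leq_ltn_trans nm; rewrite -ltnS.
Qed.

Lemma ps_mulA : associative ps_mul.
Proof.
suff E f g h n : coefs (ps_mul f (ps_mul g h)) n =
    (trunc n.+1 f * (trunc n.+1 g * trunc n.+1 h))`_n.
  move=> f g h; apply/powserP=> n.
  by rewrite E [ps_mul (ps_mul f g) h]ps_mulC E mulrA [_ * trunc _ h]mulrC.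
rewrite coef_mul_trunc //; apply: eq_bigr => i _.
by rewrite (@coef_ps_mul n.+1) // ltnS leq_subr.
Qed.

Lemma ps_mul1 : left_id ps_one ps_mul.
Proof.
move=> f; apply/powserP=> n /=; rewrite big_ord_recl /= subn0 mul1r.
by rewrite big1 ?addr0 // => i _; rewrite /= mul0r.
Qed.

Lemma ps_mulD : left_distributive ps_mul ps_add.
Proof.
move=> f g h; apply/powserP=> n /=; rewrite -big_split /=.
by apply: eq_bigr => i _; rewrite mulrDl.
Qed.

Lemma ps_one_neq0 : ps_one != 0.
Proof.
by apply/eqP=> /(congr1 (fun f => coefs f 0)) /eqP; rewrite /= oner_eq0.
Qed.

HB.instance Definition _ := GRing.Zmodule_isComNzRing.Build (powser R)
  ps_mulA ps_mulC ps_mul1 ps_mulD ps_one_neq0.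

(** The coefficient as a map on series, for each index an additive one. *)
Definition coef n f := coefs f n.
Arguments coef : simpl never.

Lemma psP f g : (forall n, coef n f = coef n g) -> f = g.
Proof. exact: powserP. Qed.

Fact coef_is_zmod_morphism n : zmod_morphism (coef n).
Proof. by []. Qed.
HB.instance Definition _ n :=
  GRing.isZmodMorphism.Build (powser R) R (coef n) (coef_is_zmod_morphism n).

Lemma coef_ps1 n : coef n 1 = (n == 0)%:R. Proof. by []. Qed.

Lemma coef_psD n f g : coef n (f + g) = coef n f + coef n g.
Proof. by []. Qed.

Lemma coef_psB n f g : coef n (f - g) = coef n f - coef n g.
Proof. by []. Qed.

Lemma coef_psN n f : coef n (- f) = - coef n f.
Proof. by []. Qed.

Lemma coef_psM n f g :
  coef n (f * g) = \sum_(i < n.+1) coef i f * coef (n - i) g.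
Proof. by []. Qed.

Lemma coef0_psM f g : coef 0 (f * g) = coef 0 f * coef 0 g.
Proof. by rewrite coef_psM big_ord1. Qed.

Definition ps_q : powser R := PowSer (fun n => (n == 1)%:R).

Lemma coef_qM n f : coef n (ps_q * f) = if n is m.+1 then coef m f else 0.
Proof.
rewrite coef_psM big_ord_recl /= mul0r add0r; case: n => [|n].
  by rewrite big_ord0.
rewrite big_ord_recl /= mul1r subSS subn0 big1 ?addr0 // => i _.
by rewrite /= mul0r.
Qed.

Lemma coef_qnM k n f :
  coef n (ps_q ^+ k * f) = if (k <= n)%N then coef (n - k) f else 0.
Proof.
elim: k n => [|k IH] n; first by rewrite expr0 mul1r subn0.
by rewrite exprS -mulrA coef_qM; case: n => // n; rewrite IH.
Qed.

Lemma coef_qn k n : coef n (ps_q ^+ k) = (n == k)%:R.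
Proof.
rewrite -[ps_q ^+ k]mulr1 coef_qnM coef_ps1; case: leqP => [kn|/ltn_eqF->//].
by rewrite subn_eq0 eqn_leq kn andbT.
Qed.

Lemma qn_lreg k f g : ps_q ^+ k * f = ps_q ^+ k * g -> f = g.
Proof.
move=> E; apply/psP=> n; have := congr1 (coef (n + k)) E.
by rewrite !coef_qnM leq_addl addnK.
Qed.

(** Congruence modulo [q ^ N], which takes the place of convergence. *)
Definition eqmodq N f g := trunc N f = trunc N g.

Lemma eqmodqP N f g :
  eqmodq N f g <-> (forall n, (n < N)%N -> coef n f = coef n g).
Proof.
split=> [/polyP E n nN|E]; first by have := E n; rewrite !coef_poly nN.
by apply/polyP=> n; rewrite !coef_poly; case: ifP => // /E.
Qed.

Lemma eqmodq_refl N f : eqmodq N f f. Proof. by []. Qed.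
Hint Resolve eqmodq_refl : core.

Lemma eqmodq_sym N f g : eqmodq N f g -> eqmodq N g f.
Proof. exact: esym. Qed.

Lemma eqmodq_trans N g f h : eqmodq N f g -> eqmodq N g h -> eqmodq N f h.
Proof. exact: etrans. Qed.

Lemma eqmodqW N M f g : (M <= N)%N -> eqmodq N f g -> eqmodq M f g.
Proof.
move=> MN /eqmodqP E; apply/eqmodqP=> n nM; apply: E.
exact: leq_trans MN.
Qed.

Lemma eqmodqD N f1 g1 f2 g2 :
  eqmodq N f1 g1 -> eqmodq N f2 g2 -> eqmodq N (f1 + f2) (g1 + g2).
Proof.
move=> /eqmodqP E /eqmodqP F; apply/eqmodqP=> n nN.
by rewrite !coef_psD E ?F.
Qed.

Lemma eqmodqB N f1 g1 f2 g2 :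
  eqmodq N f1 g1 -> eqmodq N f2 g2 -> eqmodq N (f1 - f2) (g1 - g2).
Proof.
move=> /eqmodqP E /eqmodqP F; apply/eqmodqP=> n nN.
by rewrite !coef_psB E ?F.
Qed.

Lemma eqmodqM N f1 g1 f2 g2 :
  eqmodq N f1 g1 -> eqmodq N f2 g2 -> eqmodq N (f1 * f2) (g1 * g2).
Proof.
move=> /eqmodqP E /eqmodqP F; apply/eqmodqP=> n nN.
rewrite !coef_psM; apply: eq_bigr => i _.
by rewrite E ?F //; apply: leq_ltn_trans nN; rewrite ?leq_subr // -ltnS.
Qed.

Lemma eqmodq_sum N (I : Type) (r : seq I) (F G : I -> powser R) :
  (forall i, eqmodq N (F i) (G i)) ->
  eqmodq N (\sum_(i <- r) F i) (\sum_(i <- r) G i).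
Proof.
move=> E; apply/eqmodqP=> n nN; rewrite !raddf_sum; apply: eq_bigr => i _.
by have /eqmodqP := E i; apply.
Qed.

Lemma eqmodq_qn0 N k f : (N <= k)%N -> eqmodq N (ps_q ^+ k * f) 0.
Proof.
move=> Nk; apply/eqmodqP=> n nN.
by rewrite coef_qnM leqNgt (leq_trans nN Nk) raddf0.
Qed.

Lemma eqmodq_eq f g : (forall N, eqmodq N f g) -> f = g.
Proof. by move=> E; apply/psP=> n; have /eqmodqP := E n.+1; apply. Qed.

(** The inverse is the geometric series in [1 - f], of which only the terms
    of exponent at most [n] contribute to the coefficient [n]. *)
Lemma ps_inv f : coef 0 f = 1 -> exists g, f * g = 1.
Proof.
move=> f0; set u := 1 - f.
have u_val n m : (m < n)%N -> coef m (u ^+ n) = 0.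
  elim: n m => // n IH m mn; rewrite exprS coef_psM big1 // => -[[|i] lei] _ /=.
    by rewrite coef_psB f0 coef_ps1 subrr mul0r.
  by rewrite IH ?mulr0 // ; lia.
have geom n : f * (\sum_(i < n) u ^+ i) = 1 - u ^+ n.
  elim: n => [|n IH]; first by rewrite big_ord0 mulr0 expr0 subrr.
  by rewrite big_ord_recr /= mulrDr IH exprS /u; ring.
pose g := PowSer (fun n => coef n (\sum_(i < n.+1) u ^+ i)).
have gE n m : (m <= n)%N -> coef m g = coef m (\sum_(i < n.+1) u ^+ i).
  elim: n => [|n IH]; first by rewrite leqn0 => /eqP->.
  rewrite leq_eqVlt ltnS => /predU1P[->//|mn].
  by rewrite big_ord_recr coef_psD /= u_val ?addr0 ?IH.
exists g; apply/psP=> n.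
rewrite -[RHS]subr0 -(@u_val n.+1 n) // -coef_psB -geom.
rewrite !coef_psM; apply: eq_bigr => i _; congr (_ * _).
by apply: gE; rewrite leq_subr.
Qed.

Lemma ps_unitI f g h : coef 0 f = 1 -> f * g = f * h -> g = h.
Proof.
case/ps_inv=> f' ff' E; rewrite -[g]mul1r -[h]mul1r -ff' mulrC.
by rewrite mulrAC mulrC -E; ring.
Qed.

Lemma eqmodq_unitI N f g h :
  coef 0 f = 1 -> eqmodq N (f * g) (f * h) -> eqmodq N g h.
Proof.
case/ps_inv=> f' ff' E; rewrite -[g]mul1r -[h]mul1r -ff' ![f * f']mulrC -!mulrA.
exact: eqmodqM.
Qed.

(** * The substitutions [q -> q ^ 2] and [q -> - q] and the operator [U] *)

Definition psU f : powser R := PowSer (fun n => coef n.*2 f).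
Definition psV f : powser R :=
  PowSer (fun n => if odd n then 0 else coef n./2 f).
Definition psN f : powser R := PowSer (fun n => (-1) ^+ n * coef n f).

Lemma coef_U n f : coef n (psU f) = coef n.*2 f. Proof. by []. Qed.
Lemma coef_V n f : coef n (psV f) = if odd n then 0 else coef n./2 f.
Proof. by []. Qed.
Lemma coef_V2 n f : coef n.*2 (psV f) = coef n f.
Proof. by rewrite coef_V odd_double doubleK. Qed.
Lemma coef_N n f : coef n (psN f) = (-1) ^+ n * coef n f. Proof. by []. Qed.

Fact psU_is_zmod_morphism : zmod_morphism psU.
Proof. by []. Qed.
HB.instance Definition _ :=
  GRing.isZmodMorphism.Build (powser R) (powser R) psU psU_is_zmod_morphism.

Fact psV_is_zmod_morphism : zmod_morphism psV.
Proof.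
move=> f g; apply/psP=> n; rewrite coef_psB !coef_V coef_psB.
by case: odd; rewrite ?subr0.
Qed.
HB.instance Definition _ :=
  GRing.isZmodMorphism.Build (powser R) (powser R) psV psV_is_zmod_morphism.

Fact psN_is_zmod_morphism : zmod_morphism psN.
Proof.
by move=> f g; apply/psP=> n; rewrite coef_psB !coef_N coef_psB mulrBr.
Qed.
HB.instance Definition _ :=
  GRing.isZmodMorphism.Build (powser R) (powser R) psN psN_is_zmod_morphism.

Lemma big_ord_even_odd n (F : nat -> R) :
  \sum_(i < n.*2.+1) F i =
    \sum_(i < n.+1) F i.*2 + \sum_(i < n) F i.*2.+1.
Proof.
elim: n => [|n IH]; first by rewrite !big_ord1 big_ord0 addr0.
rewrite doubleS 2!big_ord_recr /= IH.
by rewrite [in RHS]big_ord_recr [X in _ = _ + X]big_ord_recr /= doubleS; ring.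
Qed.

Lemma psU_V f g : psU (psV f * g) = f * psU g.
Proof.
apply/psP=> n; rewrite coef_U coef_psM.
rewrite (@big_ord_even_odd n (fun i => coef i (psV f) * coef (n.*2 - i) g)).
rewrite [X in _ + X]big1 ?addr0 => [|i _]; last first.
  by rewrite coef_V /= odd_double mul0r.
rewrite coef_psM; apply: eq_bigr => i _.
by rewrite coef_V2 coef_U doubleB.
Qed.

Lemma psVK f : psU (psV f) = f.
Proof. by apply/psP=> n; rewrite coef_U coef_V2. Qed.

Fact psV_is_monoid_morphism : monoid_morphism psV.
Proof.
split=> [|f g]; first by apply/psP=> -[|[|n]] //; rewrite coef_V /=; case: odd.
apply/psP=> n; rewrite coef_V; case: ifP => [odd_n|/negbT even_n].
  rewrite coef_psM big1 // => i _; rewrite !coef_V.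
  case: ifP; rewrite ?mul0r // => even_i; rewrite oddB -1?ltnS //.
  by rewrite odd_n even_i mulr0.
rewrite -[in RHS](even_halfK even_n); set m := n./2.
by rewrite -[in RHS]coef_U psU_V psVK.
Qed.
HB.instance Definition _ :=
  GRing.isMonoidMorphism.Build (powser R) (powser R) psV psV_is_monoid_morphism.

Fact psN_is_monoid_morphism : monoid_morphism psN.
Proof.
split=> [|f g]; first by apply/psP=> -[|n]; rewrite coef_N ?mul1r // mulr0.
apply/psP=> n; rewrite coef_N !coef_psM mulr_sumr; apply: eq_bigr => i _.
by rewrite !coef_N mulrACA -exprD subnKC // -ltnS.
Qed.
HB.instance Definition _ :=
  GRing.isMonoidMorphism.Build (powser R) (powser R) psN psN_is_monoid_morphism.

Lemma psV_q : psV ps_q = ps_q ^+ 2.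
Proof.
apply/psP=> n; rewrite coef_qn coef_V.
have [odd_n|even_n] := ifPn; first by case: n odd_n => [|[|[|]]].
by rewrite -[in RHS](even_halfK even_n) (inj_eq double_inj (n./2) 1%N).
Qed.

Lemma psN_q : psN ps_q = - ps_q.
Proof.
apply/psP=> -[|[|n]]; rewrite coef_N coef_psN.
- by rewrite mulr0 oppr0.
- by rewrite mulN1r.
- by rewrite mulr0 oppr0.
Qed.

Lemma psNK : involutive psN.
Proof. by move=> f; apply/psP=> n; rewrite !coef_N signrMK. Qed.

(** The even part of a series, in two ways. *)
Lemma addr_psN f : f + psN f = psV (psU f) *+ 2.
Proof.
apply/psP=> n; rewrite raddfMn /= coef_psD coef_N coef_V coef_U -signr_odd.
case: ifP => [_|/negbT/even_halfK ->]; first by rewrite mulN1r subrr mul0rn.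
by rewrite mul1r.
Qed.

Lemma eqmodq_V N f g : eqmodq N f g -> eqmodq N (psV f) (psV g).
Proof.
move=> /eqmodqP E; apply/eqmodqP=> n nN; rewrite !coef_V.
case: ifP => // _; apply: E.
by apply: leq_ltn_trans nN; lia.
Qed.

Lemma eqmodq_N N f g : eqmodq N f g -> eqmodq N (psN f) (psN g).
Proof.
by move=> /eqmodqP E; apply/eqmodqP=> n nN; rewrite !coef_N E.
Qed.

End PowSer.

Hint Resolve eqmodq_refl : core.

Arguments coef : simpl never.
Local Notation series := (powser int).
Local Notation q := (ps_q int).

(** * Generating functions of regular overpartitions *)

Section Overpartitions.
Local Open Scope nat_scope.
Variable k : nat.

(** All [k]-regular overpartitions of [n] with parts at most [m]; the fuel [f]
    has to be at least [m + n].  The largest possible part [m] either does not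
    occur, or it is overlined and then occurs once, or it is removed from the
    front without restricting what follows. *)
Fixpoint overparts f m n : seq (seq (nat * bool)) :=
  match f, m with
  | f'.+1, m'.+1 =>
      overparts f' m' n ++
      (if ~~ (k %| m) && (m <= n) then
         [seq (m, true) :: s | s <- overparts f' m' (n - m)] ++
         [seq (m, false) :: s | s <- overparts f' m (n - m)]
       else [::])
  | _, _ => if n == 0 then [:: [::]] else [::]
  end.

Definition is_bounded m (s : seq (nat * bool)) := all (fun x => x.1 <= m) s.

(** An overlined first part forces the other parts to be smaller; this is the
    truncated subtraction of the flag. *)
Lemma is_overpartition_cons x s :
  is_overpartition (x :: s) =
    [&& 0 < x.1, is_bounded (x.1 - x.2) s & is_overpartition s].
Proof.
rewrite /is_overpartition /is_bounded /= (path_sortedE); last first.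
  by move=> a b c /= ba cb; apply: leq_trans cb ba.
rewrite all_map -!andbA; case: x => [p b] /=.
case p0: (0 < p); last by rewrite !(andbF, andFb).
have -> : all (fun y => y.1 <= p - b) s =
    all (preim fst (geq p)) s && all (fun y => b ==> (p != y.1)) s.
  by rewrite -all_predI; apply: eq_all => y /=; case: b; lia.
by do 3!case: all => //=; rewrite ?andbF.
Qed.

Lemma mem_overparts f m n s : m + n <= f ->
  (s \in overparts f m n) =
    [&& is_overpartition s, regular k s, is_bounded m s & weight s == n].
Proof.
elim: f m n s => [|f IH] m n s le_f.
  have [-> ->] : m = 0 /\ n = 0 by lia.
  rewrite inE; case: s => [|x s]; first by rewrite /weight big_nil.
  rewrite is_overpartition_cons /= leqn0; case: (x.1) => //= p.
  by rewrite !andbF.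
case: m le_f => [|m] le_f /=.
  have -> : (s \in if n == 0 then [:: [::]] else [::]) =
      (s == [::]) && (n == 0) by case: eqP => _; rewrite ?inE ?andbT ?andbF.
  case: s => [|x s]; first by rewrite /weight big_nil /= eq_sym.
  rewrite is_overpartition_cons /= leqn0; case: (x.1) => //= p.
  by rewrite !andbF.
rewrite mem_cat IH; last by lia.
case: s => [|[p b] s].
  rewrite /= /weight big_nil; case: (0 == n) => //=.
  case: ifP => //= _; rewrite mem_cat; apply/norP; split.
    by apply/mapP=> -[].
  by apply/mapP=> -[].
rewrite /= is_overpartition_cons /weight big_cons -/(weight s) /=.
have mem_cons (c : bool) l : ((p, b) :: s \in [seq (m.+1, c) :: t | t <- l]) =
    [&& p == m.+1, b == c & s \in l].
  apply/mapP/and3P => [[t tl [-> -> ->]]|[/eqP-> /eqP-> sl]].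
    by rewrite !eqxx.
  by exists s.
have -> : ((p, b) :: s \in
    (if ~~ (k %| m.+1) && (m < n) then
      [seq (m.+1, true) :: t | t <- overparts f m (n - m.+1)] ++
      [seq (m.+1, false) :: t | t <- overparts f m.+1 (n - m.+1)]
    else [::])) =
  [&& p == m.+1, ~~ (k %| m.+1), m < n, is_overpartition s, regular k s,
    is_bounded (m.+1 - b) s & weight s == n - m.+1].
  case: ifP => [/andP[-> lt_mn]|/negbT/nandP [/negbTE->|/negbTE->]].
  - rewrite mem_cat !mem_cons !IH ?lt_mn; [|lia..].
    by case: (b); rewrite andbF ?orbF ?subn1 ?subn0.
  - by rewrite ?andbF.
  - by rewrite ?andbF.
have [->|p_neq] /= := eqVneq p m.+1.
  rewrite ltnn !andbF /= leqnn.
  have -> : (m.+1 + weight s == n) = (m < n) && (weight s == n - m.+1) by lia.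
  have bW : is_bounded (m.+1 - b) s -> is_bounded m.+1 s.
    by apply: sub_all => y /=; lia.
  case: is_overpartition; rewrite ?(andbF, andbT) //=.
  case: (regular k s); rewrite ?(andbF, andbT) //=.
  case: is_bounded bW => [bW|_] /=; last by rewrite !andbF.
  rewrite bW // ?andbT.
rewrite orbF.
have -> : (p <= m.+1) = (p <= m) by rewrite leq_eqVlt (negPf p_neq).
case le_pm: (p <= m); rewrite /= ?andbF //.
have [bs|] /= := boolP (is_bounded (p - b) s); last by rewrite ?andbF.
have -> : is_bounded m s by apply: sub_all bs => y /=; lia.
by have -> : is_bounded m.+1 s by apply: sub_all bs => y /=; lia.
Qed.

Lemma overparts_uniq f m n : m + n <= f -> uniq (overparts f m n).
Proof.
elim: f m n => [|f IH] m n le_f /=; first by case: (n == 0).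
case: m le_f => [|m] le_f; first by case: (n == 0).
have inj_cons (x : nat * bool) : injective (cons x) by move=> ? ? [].
rewrite cat_uniq IH; last by lia.
case: ifP => //= /andP[_ lt_mn].
rewrite cat_uniq !(map_inj_uniq (inj_cons _)) !IH ?andbT /=; [|lia..].
apply/andP; split; apply/hasPn=> s.
  rewrite mem_cat => /orP[] /mapP[t _ ->];
    by rewrite mem_overparts /= ?ltnn ?andbF //; lia.
by move/mapP=> [t _ ->]; apply/mapP=> -[].
Qed.

Lemma overparts_fuel f g m n : m + n <= f -> m + n <= g ->
  overparts f m n = overparts g m n.
Proof.
elim: f g m n => [|f IH] g m n le_f le_g.
  have [-> ->] : m = 0 /\ n = 0 by lia.
  by case: g {le_g}.
case: m le_f le_g => [|m] le_f le_g; first by case: g {le_g}.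
case: g le_g => [|g] le_g //=; rewrite (IH g) //; try lia.
case: ifP => // /andP[_ lt_mn].
by rewrite (IH g) ?(IH g m.+1) //; lia.
Qed.

Definition n_overparts m n := size (overparts (m + n) m n).

Lemma n_overparts0 n : n_overparts 0 n = (n == 0).
Proof. by rewrite /n_overparts; case: n. Qed.

Lemma n_overpartsS m n : n_overparts m.+1 n = n_overparts m n +
  (if ~~ (k %| m.+1) && (m < n) then
     n_overparts m (n - m.+1) + n_overparts m.+1 (n - m.+1) else 0).
Proof.
rewrite {1}/n_overparts addSn /= size_cat; congr (_ + _).
case: ifP => // /andP[_ lt_mn]; rewrite size_cat !size_map.
rewrite /n_overparts; congr (_ + _); congr size; apply: overparts_fuel; lia.
Qed.

(** Parts larger than [n] do not occur in an overpartition of [n], so the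
    counts have a limit in [m]. *)
Lemma n_overparts_stable m n : n <= m -> n_overparts m n = n_overparts n n.
Proof.
move/subnKC <-; elim: (m - n) => [|d IH]; first by rewrite addn0.
by rewrite addnS n_overpartsS IH [_ < n]ltnNge leq_addr andbF addn0.
Qed.

(** Toggling the overline of the last part pairs off the nonempty
    overpartitions. *)
Lemma odd_n_overparts m n : odd (n_overparts m n) = (n == 0).
Proof.
elim: m n => [|m IHm] n; first by rewrite n_overparts0; case: (n == 0).
elim/ltn_ind: n => n IHn; rewrite n_overpartsS oddD IHm.
case: ifP => [/andP[_ lt_mn]|_]; last by rewrite addbF.
by rewrite oddD IHm IHn ?addbb ?addbF //; lia.
Qed.

Lemma Bbar_convolution n :
  Bbar k n = \sum_(i < n.+1) n_overparts i i * n_overparts (n - i) (n - i).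
Proof.
pose ov i := overparts (i + i) i i.
have ovP i s : (s \in ov i) =
    [&& is_overpartition s, regular k s & weight s == i].
  rewrite mem_overparts //; case: eqP => [<-|]; rewrite ?andbF ?andbT //.
  suff -> : is_bounded (weight s) s by rewrite andbT.
  apply/allP=> x xs; rewrite /weight (big_rem x) //=; exact: leq_addr.
pose prs i := [seq (s, t) | s <- ov i, t <- ov (n - i)].
rewrite (@Bbar_enum k n [seq p | i <- iota 0 n.+1, p <- prs i]).
- rewrite size_allpairs_dep sumnE big_map -[n.+1]subn0 -/(index_iota _ _).
  by rewrite big_mkord; apply: eq_bigr => i _; rewrite size_allpairs.
- apply: allpairs_uniq_dep => [|i _|[i p] [j r]]; first exact: iota_uniq.
    by rewrite allpairs_uniq ?overparts_uniq // => -[s t] [s' t'] _ _ [-> ->].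
  move=> /allpairsPdep[i0 [p0 [_ Hp [-> ->]]]].
  move=> /allpairsPdep[j0 [r0 [_ Hr [-> ->]]]].
  move=> /= E; rewrite E in Hp *.
  case/allpairsP: Hp => -[s t] /= [Hs _ rE].
  case/allpairsP: Hr => -[s' t'] /= [Hs' _].
  rewrite rE => -[ss' _]; move: Hs Hs'; rewrite -ss' !ovP.
  by move=> /and3P[_ _ /eqP<-] /and3P[_ _ /eqP<-].
move=> [s t]; apply/allpairsPdep/and5P => [[i [p [Hi /allpairsP[[s' t'] ]]]]|].
  rewrite !ovP => -[/and3P[os rs /eqP ws] /and3P[ot rt /eqP wt] ->] [-> ->].
  by split=> //; rewrite ws wt subnKC // -ltnS; move: Hi; rewrite mem_iota.
move=> [os ot rs rt /eqP w]; exists (weight s), (s, t); split=> //.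
  by rewrite mem_iota; move: w => /=; lia.
apply/allpairsP; exists (s, t); split=> //=; rewrite ovP ?os ?ot ?rs ?rt //=.
by rewrite -w addKn.
Qed.

End Overpartitions.

Section GeneratingFunctions.
Local Open Scope ring_scope.
Implicit Types (k m n : nat).

Definition ovgf_upto k m : series := PowSer (fun n => (n_overparts k m n)%:R).
Definition ovgf k : series := PowSer (fun n => (n_overparts k n n)%:R).

Lemma Bbar_gf k n : (Bbar k n)%:R = coef n (ovgf k ^+ 2).
Proof.
rewrite Bbar_convolution expr2 coef_psM natr_sum; apply: eq_bigr => i _.
by rewrite natrM.
Qed.

Lemma ovgf_uptoP k m : eqmodq m.+1 (ovgf_upto k m) (ovgf k).
Proof.
by apply/eqmodqP=> n; rewrite ltnS /coef /= => /n_overparts_stable->.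
Qed.

(** At [s = 1] and at [s = - 1] these are the numerator and the denominator of
    the product formula for [ovgf_upto]. *)
Fixpoint regprod k (s : series) m : series :=
  if m is m'.+1 then
    regprod k s m' * (if (k %| m)%N then 1 else 1 + s * q ^+ m)
  else 1.

(** A new largest part [m] multiplies the series by
    [(1 + q ^ m) / (1 - q ^ m)]: this is the recurrence [n_overpartsS]. *)
Lemma ovgf_upto_frac k m : ovgf_upto k m * regprod k (-1) m = regprod k 1 m.
Proof.
elim: m => [|m IH] /=.
  by rewrite mulr1; apply/psP=> n; rewrite /coef /= n_overparts0; case: n.
rewrite mulrA mulrAC -IH; case: ifP => [k_m|/negbT k_m]; last first.
  rewrite [RHS]mulrAC; congr (_ * _); rewrite mulN1r mul1r mulrBr mulrDr !mulr1.
  apply/psP=> n; rewrite ![_ * q ^+ _]mulrC coef_psB coef_psD !coef_qnM.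
  rewrite /coef /= n_overpartsS k_m /=; case: ltnP => _; rewrite ?natrD //; lia.
rewrite !mulr1; congr (_ * _); apply/psP=> n.
by rewrite /coef /= n_overpartsS k_m addn0.
Qed.

Lemma coef0_regprod k s m : coef 0 (regprod k s m) = 1.
Proof.
elim: m => //= m IH; rewrite coef0_psM IH mul1r; case: ifP => // _.
by rewrite coef_psD mulrC coef_qnM addr0.
Qed.

Lemma regprod_double k (s : int) m : (0 < k)%N ->
  regprod k.*2 s%:~R m.*2 = regprod 2 s%:~R m.*2 * psV (regprod k s%:~R m).
Proof.
move=> k0; elim: m => [|m IH]; first by rewrite /= rmorph1 mulr1.
rewrite doubleS /= IH rmorphM /=.
have -> : (k.*2 %| m.*2.+1)%N = false by apply/negP; rewrite -!muln2; lia.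
have -> : (2 %| m.*2.+1)%N = false by lia.
have -> : (2 %| m.*2.+2)%N by lia.
have -> : (k.*2 %| m.*2.+2)%N = (k %| m.+1)%N.
  by rewrite -doubleS -!muln2 dvdn_pmul2r.
have -> : psV (if (k %| m.+1)%N then 1 else 1 + s%:~R * q ^+ m.+1) =
    if (k %| m.+1)%N then 1 else 1 + s%:~R * q ^+ m.*2.+2.
  case: ifP => _; first by rewrite rmorph1.
  rewrite rmorphD rmorphM rmorph1 rmorph_int rmorphXn /= psV_q -exprM.
  by rewrite mul2n doubleS.
by rewrite mulr1 [RHS]mulrACA [RHS]mulrA.
Qed.

(** A part not divisible by [2 * k] is either odd, or twice a part not
    divisible by [k]. *)
Lemma ovgf_double k : (0 < k)%N -> ovgf k.*2 = ovgf 2 * psV (ovgf k).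
Proof.
move=> k0; apply: eqmodq_eq => -[|N]; first exact/eqmodqP.
have uptoE : ovgf_upto k.*2 N.*2 = ovgf_upto 2 N.*2 * psV (ovgf_upto k N).
  apply: (@ps_unitI _ (regprod k.*2 (-1) N.*2)); first exact: coef0_regprod.
  rewrite mulrC ovgf_upto_frac.
  have := regprod_double 1 N k0; rewrite mulr1z => ->.
  have := regprod_double (-1) N k0; rewrite mulrN1z => ->.
  rewrite -!ovgf_upto_frac rmorphM /=; ring.
have leN : (N.+1 <= N.*2.+1)%N by lia.
apply: eqmodq_trans (eqmodqW leN (eqmodq_sym (ovgf_uptoP _ _))) _.
rewrite uptoE; apply: eqmodqM; first exact: eqmodqW (ovgf_uptoP _ _).
exact/eqmodq_V/ovgf_uptoP.
Qed.

Lemma ovgf1 : ovgf 1 = 1.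
Proof.
apply: eqmodq_eq => N.
apply: eqmodq_trans (eqmodqW (leqnSn N) (eqmodq_sym (ovgf_uptoP _ _))) _.
suff -> : ovgf_upto 1 N = 1 by [].
have E s m : regprod 1 s m = 1 by elim: m => //= m ->; rewrite dvd1n mulr1.
by have := ovgf_upto_frac 1 N; rewrite !E mulr1.
Qed.

Definition oddprod (s : series) m : series :=
  \prod_(i < m) (1 + s * q ^+ i.*2.+1).

Lemma regprod2 s m : regprod 2 s m.*2 = oddprod s m.
Proof.
elim: m => [|m IH]; first by rewrite /oddprod big_ord0.
rewrite doubleS /= IH /oddprod big_ord_recr /=.
have -> : (2 %| m.*2.+1)%N = false by lia.
have -> : (2 %| m.*2.+2)%N by lia.
by rewrite mulr1.
Qed.

Lemma ovgf2_oddprod m :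
  eqmodq m.*2.+1 (ovgf 2 * oddprod (-1) m) (oddprod 1 m).
Proof.
rewrite -!regprod2 -ovgf_upto_frac; apply: eqmodqM => //.
exact/eqmodq_sym/ovgf_uptoP.
Qed.

Lemma ovgf_mod2 k : exists z, ovgf k = 1 + z *+ 2.
Proof.
exists (PowSer (fun n => (n_overparts k n n)./2%:R)); apply/psP=> n.
rewrite coef_psD raddfMn coef_ps1 /coef /= -mulrnA -natrD.
by rewrite -[in LHS](odd_double_half (n_overparts k n n)) odd_n_overparts muln2.
Qed.

End GeneratingFunctions.

(** * The theta series and its product formula *)

Section Theta.
Local Open Scope ring_scope.

Definition zrange (M : nat) : seq int :=
  [seq i%:Z - M%:Z | i <- iota 0 M.*2.+1].

Lemma mem_zrange M x : (x \in zrange M) = (`|x| <= M)%N.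
Proof.
apply/mapP/idP => [[i]|le_xM]; first by rewrite mem_iota => ? ->; lia.
by exists `|(x + M%:Z)%R|%N; rewrite ?mem_iota; lia.
Qed.

Lemma zrange_uniq M : uniq (zrange M).
Proof. by rewrite map_inj_uniq ?iota_uniq // => i j; lia. Qed.

(** [theta] is the sum of [q ^ (x ^ 2)] over all integers [x]; only
    [|x| <= n] contributes to the coefficient [n]. *)
Definition theta : series :=
  PowSer (fun n => (count (fun x => `|x| ^ 2 == n)%N (zrange n))%:R).

Lemma coef_theta M n : (n <= M)%N ->
  coef n theta = (count (fun x => `|x| ^ 2 == n)%N (zrange M))%:R.
Proof.
move=> le_nM; rewrite -[LHS]/(_%:R) -!size_filter; congr (_%:R).
apply/perm_size/uniq_perm; rewrite ?filter_uniq ?zrange_uniq // => x.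
rewrite !mem_filter !mem_zrange; case: eqP => //= xn.
have : (`|x| <= `|x| ^ 2)%N by rewrite -mulnn; nia.
lia.
Qed.

Lemma count_natr (T : Type) (a : pred T) (s : seq T) :
  (count a s)%:R = \sum_(x <- s) (a x)%:R :> int.
Proof.
by elim: s => [|x s IH]; rewrite ?big_nil // big_cons /= natrD IH.
Qed.

Lemma theta_sum M :
  eqmodq M.+1 theta (\sum_(x <- zrange M) q ^+ (`|x| ^ 2)%N).
Proof.
apply/eqmodqP=> n le_nM; rewrite (@coef_theta M) // count_natr raddf_sum.
by apply: eq_bigr => x _; rewrite /= coef_qn eq_sym.
Qed.

Lemma psN_theta_sum M : eqmodq M.+1 (psN theta)
  (\sum_(x <- zrange M) (-1) ^+ `|x|%N * q ^+ (`|x| ^ 2)%N).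
Proof.
have /eqmodq_N/eqmodq_trans := theta_sum M; apply.
rewrite rmorph_sum /=; apply: eqmodq_sum => x.
by rewrite rmorphXn /= psN_q [(- q) ^+ _]exprNn -signr_odd oddX orFb signr_odd.
Qed.

(** * The finite Jacobi triple product *)

Notation Q := (q%:P).

(** A polynomial in [z = 'X]: the factors [1 + z ^ (-1) * q ^ (2 * i + 1)] of
    the triple product are multiplied by [z], so that the coefficient of [z ^ x]
    is moved to index [m + x]. *)
Definition jtp m : {poly series} :=
  \prod_(i < m) ((1 + Q ^+ i.*2.+1 * 'X) * ('X + Q ^+ i.*2.+1)).

Lemma coef_comp_scaleX (R : comNzRingType) (p : {poly R}) a i :
  (p \Po (a%:P * 'X))`_i = a ^+ i * p`_i.
Proof.
rewrite mul_polyC comp_polyE coef_sum.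
under eq_bigr => j _ do rewrite exprZn scalerA coefZ coefXn.
have [lt_ip|le_pi] := ltnP i (size p).
  rewrite (bigD1 (Ordinal lt_ip)) //= eqxx mulr1 big1 ?addr0 1?mulrC // => j ij.
  by rewrite eq_sym -[_ == i]/(j == Ordinal lt_ip) (negPf ij) mulr0.
rewrite big1 ?nth_default ?mulr0 // => j _.
by rewrite eq_sym ltn_eqF ?mulr0 // (leq_trans _ le_pi).
Qed.

(** Replacing [z] by [q ^ 2 * z] shifts each of the two families of factors by
    one place, in opposite directions. *)
Lemma jtp_shift m : (jtp m \Po (Q ^+ 2 * 'X)) * (Q * 'X + Q ^+ m.*2) =
  Q ^+ m.*2 * (jtp m * (1 + Q ^+ m.*2.+1 * 'X)).
Proof.
elim: m => [|m IH].
  by rewrite /jtp big_ord0 expr0 !mul1r expr1 comp_polyC mul1r addrC.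
rewrite /jtp big_ord_recr -/(jtp m) /= doubleS.
move: IH; set k := m.*2 => IH.
have QX n p : (Q ^+ n) \Po p = Q ^+ n by rewrite -rmorphXn comp_polyC.
rewrite !(comp_polyM, comp_polyD, comp_polyC, QX, comp_polyX).
transitivity (((jtp m \Po (Q ^+ 2 * 'X)) * (Q * 'X + Q ^+ k)) *
   (Q ^+ 2 * ((1 + Q ^+ k.+3 * 'X) * ('X + Q ^+ k.+1)))).
  by rewrite !exprS expr0 rmorph1 ; ring.
by rewrite IH !exprS; ring.
Qed.

Lemma size_jtp m : (size (jtp m) <= m.*2.+1)%N.
Proof.
elim: m => [|m IH]; first by rewrite /jtp big_ord0 size_poly1.
rewrite /jtp big_ord_recr -/(jtp m) /=; set a := _ ^+ _.
have s2 : (size ((1 + a * 'X) * ('X + a))%R <= 3)%N.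
  have -> : a = (q ^+ m.*2.+1)%:P by rewrite rmorphXn.
  apply: leq_trans (size_polyMleq _ _) _.
  have : (size ('X + (q ^+ m.*2.+1)%:P)%R <= 2)%N by rewrite size_XaddC.
  have : (size (1 + (q ^+ m.*2.+1)%:P * 'X)%R <= 2)%N.
    rewrite addrC -polyC1 size_MXaddC; case: ifP => // _.
    by rewrite ltnS size_polyC leq_b1.
  by move=> /=; lia.
apply: leq_trans (size_polyMleq _ _) _; move: (leq_add IH s2).
by case: (_ + _)%N => // n; rewrite doubleS; lia.
Qed.

(** Coefficients of [z ^ (j + 1)] in [jtp_shift]. *)
Lemma jtp_coefP m j :
  q ^+ j.*2.+1 * (jtp m)`_j + q ^+ (m + j.+1).*2 * (jtp m)`_j.+1 =
  q ^+ m.*2 * ((jtp m)`_j.+1 + q ^+ m.*2.+1 * (jtp m)`_j).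
Proof.
have /(congr1 (fun p : {poly _} => p`_j.+1)) := jtp_shift m.
rewrite /= ; set f := jtp m; set g := f \Po _.
have -> : g * (Q * 'X + Q ^+ m.*2) = Q * (g * 'X) + Q ^+ m.*2 * g by ring.
have -> : f * (1 + Q ^+ m.*2.+1 * 'X) = f + Q ^+ m.*2.+1 * (f * 'X) by ring.
rewrite -!rmorphXn /= !(coefD, coefCM) !coefMX /= /g -!rmorphXn /=.
rewrite !coef_comp_scaleX.
rewrite -!exprM !mulrA -!exprD => <-.
by rewrite -exprS; congr (q ^+ _ * _ + q ^+ _ * _); lia.
Qed.

(** After division by a power of [q], the relation [jtp_coefP] says modulo
    [q ^ (2 * m + 1)] that a step from distance [t] to distance [t + 1] from the
    middle index [m] multiplies the coefficient by [q ^ (2 * t + 1)], upwards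
    as well as downwards.  The common factor is left undetermined. *)
Lemma jtp_coef_mod m j : (j <= m.*2)%N ->
  eqmodq m.*2.+1 (jtp m)`_j (q ^+ (`|j - m| ^ 2)%N * (jtp m)`_m).
Proof.
set N := m.*2.+1; set c := fun j => (jtp m)`_j; rewrite -!/(c _).
have up t : eqmodq N (c (m + t)%N) (q ^+ (t ^ 2)%N * c m).
  elim: t => [|t IH]; first by rewrite addn0 expr0 mul1r.
  apply: (@eqmodq_trans _ _ (q ^+ t.*2.+1 * c (m + t)%N)); last first.
    have -> : (t.+1 ^ 2 = t.*2.+1 + t ^ 2)%N by rewrite -!mulnn; lia.
    by rewrite exprD -mulrA; apply: eqmodqM.
  have E : q ^+ t.*2.+1 * c (m + t)%N + q ^+ (m + t.+1).*2 * c (m + t.+1)%N =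
      c (m + t.+1)%N + q ^+ N * c (m + t)%N.
apply: (@qn_lreg _ m.*2); rewrite addnS -jtp_coefP [LHS]mulrDr.
    by congr (_ + _); rewrite mulrA -exprD; congr (q ^+ _ * _); lia.

  have -> : c (m + t.+1)%N = q ^+ t.*2.+1 * c (m + t)%N +
      (q ^+ (m + t.+1).*2 * c (m + t.+1)%N - q ^+ N * c (m + t)%N).
    by rewrite addrA E addrK.
  rewrite -[X in eqmodq _ _ X]addr0; apply: eqmodqD => //.
  by rewrite -[0]subr0; apply: eqmodqB; apply: eqmodq_qn0; rewrite /N; lia.
have down t : (t <= m)%N -> eqmodq N (c (m - t)%N) (q ^+ (t ^ 2)%N * c m).
  elim: t => [|t IH] lt_tm; first by rewrite subn0 expr0 mul1r.
  apply: (@eqmodq_trans _ _ (q ^+ t.*2.+1 * c (m - t)%N)); last first.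
    have -> : (t.+1 ^ 2 = t.*2.+1 + t ^ 2)%N by rewrite -!mulnn; lia.
    by rewrite exprD -mulrA; apply: eqmodqM => //; apply/IH/ltnW.
  pose s := (m - t.+1)%N; have ms : (m - t = s.+1)%N by rewrite /s; lia.
  have E : c s + q ^+ N * c s.+1 =
      q ^+ t.*2.+1 * c s.+1 + q ^+ (m + t.+1).*2 * c s.
    apply: (@qn_lreg _ s.*2.+1).
    transitivity (q ^+ s.*2.+1 * c s + q ^+ (m + s.+1).*2 * c s.+1).
      rewrite [LHS]mulrDr mulrA -exprD.
      by congr (_ + q ^+ _ * _); rewrite /N /s; lia.
    rewrite jtp_coefP [LHS]mulrDr [RHS]mulrDr.
    congr (_ + _); rewrite [RHS]mulrA -exprD.
      by congr (q ^+ _ * _); rewrite /s; lia.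
    by rewrite [LHS]mulrA -exprD; congr (q ^+ _ * _); rewrite /N /s; lia.
  have -> : c (m - t.+1)%N = q ^+ t.*2.+1 * c (m - t)%N +
      (q ^+ (m + t.+1).*2 * c s - q ^+ N * c s.+1).
    by rewrite ms addrA -E addrK.
  rewrite -[X in eqmodq _ _ X]addr0; apply: eqmodqD => //.
  by rewrite -[0]subr0; apply: eqmodqB; apply: eqmodq_qn0; rewrite /N; lia.
move=> le_j; case: (leqP m j) => [le_mj|/ltnW le_jm].
  by rewrite -{1}(subnKC le_mj) distnEl //; exact: up.
by rewrite -{1}(subKn le_jm) distnEr //; apply: down; rewrite leq_subr.
Qed.

Lemma sum_zrange (V : nmodType) (G : int -> V) m :
  \sum_(x <- zrange m) G x = \sum_(i < m.*2.+1) G (i%:Z - m%:Z).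
Proof.
by rewrite big_map -[m.*2.+1]subn0 -/(index_iota _ _) big_mkord subn0.
Qed.

(** For [s = 1] and [s = - 1] the two families of factors of the triple product
    agree at [z = s], up to the sign [s ^ m]. *)
Lemma oddprod_sqr (s : series) m : s * s = 1 ->
  eqmodq m.*2.+1 (oddprod s m ^+ 2)
    ((jtp m)`_m * \sum_(x <- zrange m) s ^+ `|x|%N * q ^+ (`|x| ^ 2)%N).
Proof.
move=> ss; have sn n : s ^+ n * s ^+ n = 1 by rewrite -exprMn ss expr1n.
have -> : oddprod s m ^+ 2 = s ^+ m * (jtp m).[s].
  rewrite /jtp horner_prod /oddprod -prodrXl -[in s ^+ m](card_ord m).
  rewrite -prodr_const -big_split; apply: eq_bigr => i _ /=.
  rewrite !(hornerM, hornerD, hornerX, horner_exp, hornerC).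
  transitivity ((1 + s * q ^+ i.*2.+1) * (s * s + s * q ^+ i.*2.+1)).
    by rewrite ss expr2.
  by ring.
rewrite (horner_coef_wide _ (size_jtp m)) sum_zrange !mulr_sumr.
apply: eqmodq_sum => i; rewrite mulrCA mulrA.
have -> : s ^+ `|i%:Z - m%:Z|%N = s ^+ m * s ^+ i.
  case: (leqP m i) => [le_mi|/ltnW le_im].
    by rewrite distnEl // -[in s ^+ i](subnK le_mi) exprD mulrCA sn mulr1.
  by rewrite distnEr // -[in s ^+ m](subnK le_im) exprD -mulrA sn mulr1.
rewrite -mulrA [X in eqmodq _ _ X]mulrA [X in eqmodq _ _ X]mulrC.
rewrite [X in eqmodq _ _ X]mulrA; apply: eqmodqM => //.
by apply: jtp_coef_mod; rewrite -ltnS.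
Qed.

(** By [oddprod_sqr], the numerator and the denominator of the product for
    [ovgf 2 ^+ 2] are [theta (q)] and [theta (- q)] times the same middle
    coefficient of the triple product, which cancels. *)
Lemma theta_ratio : ovgf 2 ^+ 2 * psN theta = theta.
Proof.
apply: eqmodq_eq => -[|m]; first exact/eqmodqP.
have le_m : (m.+1 <= m.*2.+1)%N by lia.
have pos : eqmodq m.+1 (oddprod 1 m ^+ 2) ((jtp m)`_m * theta).
  apply: eqmodq_trans (eqmodqW le_m (oddprod_sqr m (mulr1 1))) _.
  apply: eqmodqM => //; apply/eqmodq_sym/(eqmodq_trans (theta_sum m)).
  by apply: eqmodq_sum => x; rewrite expr1n mul1r.
have neg : eqmodq m.+1 (oddprod (-1) m ^+ 2) ((jtp m)`_m * psN theta).
  apply: eqmodq_trans (eqmodqW le_m (oddprod_sqr m _)) _.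
    by rewrite mulrNN mulr1.
  by apply: eqmodqM => //; apply/eqmodq_sym/psN_theta_sum.
have c0 : coef 0 (jtp m)`_m = 1.
  have /eqmodqP/(_ 0%N isT) := pos; rewrite expr2 !coef0_psM.
  by rewrite -regprod2 coef0_regprod (_ : coef 0 theta = 1) // !mulr1 => <-.
apply: (eqmodq_unitI c0); apply: eqmodq_trans _ pos.
rewrite mulrCA; apply: (@eqmodq_trans _ _ (ovgf 2 ^+ 2 * oddprod (-1) m ^+ 2)).
  by apply: eqmodqM => //; apply: eqmodq_sym.
rewrite -exprMn !expr2.
by apply: eqmodqM; apply: eqmodqW le_m (ovgf2_oddprod m).
Qed.

(** * Quadratic identities between theta series *)

Lemma sum_sqr_absz (x y : int) n :
  (`|x| ^ 2 + `|y| ^ 2 == n)%N = (x * x + y * y == n%:Z).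
Proof.
have sqr (z : int) : z * z = (`|z| ^ 2)%N by rewrite -mulnn; nia.
by rewrite !sqr -PoszD.
Qed.

Lemma leq_sum_sqr a b c : (a ^ 2 + b ^ 2 == c)%N -> (a <= c)%N && (b <= c)%N.
Proof. by rewrite -!mulnn => /eqP <-; apply/andP; split; nia. Qed.

(** The map [(x, y) -> (x + y, x - y)] carries the points at square distance
    [n] from the origin onto those at square distance [2 * n]. *)
Lemma psU_theta2 : psU (theta ^+ 2) = theta ^+ 2.
Proof.
have coef2 M n : (n <= M)%N -> coef n (theta ^+ 2) =
    (count (fun p => `|p.1| ^ 2 + `|p.2| ^ 2 == n)%N
      [seq (x, y) | x <- zrange M, y <- zrange M])%:R.
  move=> le_nM; have E := theta_sum M; rewrite count_natr big_allpairs.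
  have /eqmodqP -> // := eqmodqM E E.
  rewrite big_distrlr /= raddf_sum.
  apply: eq_bigr => x _; rewrite raddf_sum; apply: eq_bigr => y _.
  by rewrite /= -exprD coef_qn eq_sym.
apply/psP=> n; rewrite coef_U (@coef2 n.*2) // (@coef2 n.*2); last by lia.
congr (_%:R); rewrite -!size_filter.
set l := [seq (x, y) | x <- zrange n.*2, y <- zrange n.*2].
have l_uniq : uniq l.
  by apply: allpairs_uniq; rewrite ?zrange_uniq // => -[a b] [c d] _ _ [-> ->].
have lP p : (p \in l) = (`|p.1| <= n.*2)%N && (`|p.2| <= n.*2)%N.
  apply/allpairsP/idP => [[[x y] /= [Hx Hy ->]]|].
    by rewrite -!mem_zrange Hx.
  by case: p => x y /andP[Hx Hy]; exists (x, y); rewrite !mem_zrange.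
clearbody l; pose f (p : int * int) := (p.1 + p.2, p.1 - p.2).
have f_inj : injective f by move=> [a b] [c d] [] H1 H2; congr (_, _); lia.
rewrite -[RHS](size_map f); apply/perm_size/uniq_perm.
- exact: filter_uniq.
- by rewrite map_inj_uniq ?filter_uniq.
move=> [u v]; rewrite mem_filter lP; apply/idP/mapP => /= [/andP[uv _]|].
  move: uv; rewrite sum_sqr_absz => /eqP uv.
  (* [u + v] is even, as its square is [2 * n + 2 * u * v] *)
  have [x ux] : exists x : int, u + v = x * 2.
    have uv2 : (u + v) * (u + v) = (n%:Z + u * v) * 2 by nia.
    have : ~~ odd `|(u + v)%R|.
      move/(congr1 absz)/(congr1 odd): uv2.
      by rewrite !abszM !oddM andbb andbF => ->.
    by exists ((u + v) %/ 2)%Z; lia.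
  have xy : x * x + (u - x) * (u - x) == n%:Z by apply/eqP; nia.
  exists (x, u - x); last by congr (_, _) => /=; lia.
  rewrite mem_filter lP /=; move: xy; rewrite -sum_sqr_absz => xy.
  by have := leq_sum_sqr xy; rewrite xy; lia.
move=> [[x y]]; rewrite mem_filter lP /= => /andP[xy _] [-> ->].
have uv : (`|(x + y)%R| ^ 2 + `|(x - y)%R| ^ 2 == n.*2)%N.
  by move: xy; rewrite !sum_sqr_absz => /eqP xy; apply/eqP; lia.
by rewrite uv leq_sum_sqr.
Qed.

(** The left side is an even series, and on the points at square distance
    [2 * m] from the origin the sign [(-1) ^ y] is [(-1) ^ m]. *)
Lemma theta_psN_theta : theta * psN theta = psV (psN (theta ^+ 2)).
Proof.
have sgnE (a b m : nat) : (a ^ 2 + b ^ 2 = m.*2)%N -> odd b = odd m.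
  rewrite -!mulnn -[a]odd_double_half -[b]odd_double_half.
  rewrite oddD odd_double addbF oddb.
  move: (a./2) (b./2) (odd a) (odd b) => a' b' [] [] /= E.
  - have -> : m = (a' * a'.+1 + b' * b'.+1).*2.+1 by lia.
    by rewrite /= odd_double.
  - by lia.
  - by lia.
  have -> : m = (a' * a' + b' * b').*2 by lia.
  by rewrite odd_double.
apply/psP=> n; rewrite coef_V; case: ifP => [odd_n|/negbT/even_halfK nE].
  (* odd [n]: the product is invariant under [q -> - q] *)
  have : psN (theta * psN theta) = theta * psN theta.
    by rewrite rmorphM /= psNK mulrC.
  move=> /(congr1 (coef n)); rewrite coef_N -signr_odd odd_n mulN1r.
  by set c := coef n _; lia.
rewrite coef_N -psU_theta2 coef_U; move: n./2 nE => m <- {n}.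
have E := theta_sum m.*2; have E' := psN_theta_sum m.*2.
have /eqmodqP -> // := eqmodqM E E'; have /eqmodqP -> // := eqmodqM E E.
rewrite !big_distrlr !raddf_sum mulr_sumr; apply: eq_bigr => x _.
rewrite !raddf_sum mulr_sumr; apply: eq_bigr => y _ /=.
rewrite mulrCA -exprD.
have -> : coef m.*2 ((-1) ^+ `|y|%N * q ^+ (`|x| ^ 2 + `|y| ^ 2)%N) =
    (-1) ^+ `|y|%N * coef m.*2 (q ^+ (`|x| ^ 2 + `|y| ^ 2)%N).
  by rewrite -signr_odd -[in RHS]signr_odd; case: odd; rewrite ?mul1r ?mulN1r.
rewrite coef_qn; case: eqP => [/esym/sgnE yE|_]; last by rewrite !mulr0.
by rewrite -signr_odd yE signr_odd.
Qed.

End Theta.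

(** * The quotient [theta (q) / theta (- q)] under the operator [U] *)

Section Tau.
Local Open Scope ring_scope.

Definition tau : series := ovgf 2 ^+ 2.

Lemma psN_theta_unit : coef 0 (psN theta ^+ 2) = 1.
Proof. by rewrite expr2 coef0_psM. Qed.

(** Multiply by [theta (- q ^ 2) ^ 2 = theta (q) * theta (- q)], which turns
    [tau] into [theta ^ 2]. *)
Lemma psU_tau : psU tau = tau ^+ 2.
Proof.
apply: (ps_unitI psN_theta_unit); rewrite -psU_V rmorphXn /=.
have -> : psV (psN theta) ^+ 2 * tau = theta ^+ 2.
  have -> : psV (psN theta) ^+ 2 = theta * psN theta.
    by rewrite -rmorphXn -rmorphXn /= theta_psN_theta.
  by rewrite -mulrA [_ * tau]mulrC theta_ratio expr2.
by rewrite psU_theta2 -exprMn mulrC theta_ratio.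
Qed.

(** The conjugate root is [tau (- q) = 1 / tau].  Multiplied by
    [theta (- q) ^ 2], the equation expresses the even part of [theta ^ 2]. *)
Lemma tau_quadratic : tau ^+ 2 + 1 = 2 * psV (tau ^+ 2) * tau.
Proof.
apply: (ps_unitI psN_theta_unit).
have -> : psN theta ^+ 2 * (tau ^+ 2 + 1) = theta ^+ 2 + psN theta ^+ 2.
  rewrite -[in X in _ = X + _]theta_ratio -/tau; ring.
rewrite -[psN theta ^+ 2]rmorphXn /= addr_psN psU_theta2.
have -> : psN (theta ^+ 2) * (2 * psV (tau ^+ 2) * tau) =
    2 * psV (tau ^+ 2) * (psN theta * (tau * psN theta)).
  by rewrite rmorphXn /=; ring.
rewrite theta_ratio [psN theta * _]mulrC theta_psN_theta -mulrA -rmorphM /=.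
by rewrite [psN (theta ^+ 2)]rmorphXn -exprMn theta_ratio mulr_natl.
Qed.

Lemma ps_natI k (f g : series) : k%:R * f = k%:R * g -> (0 < k)%N -> f = g.
Proof.
rewrite !mulr_natl => E k0; apply/psP=> n; have /(congr1 (coef n)) := E.
by rewrite !raddfMn /=; nia.
Qed.

Lemma psU_nat k (f : series) : psU (k%:R * f) = k%:R * psU f.
Proof. by rewrite !mulr_natl raddfMn. Qed.

Lemma psU1 : psU 1 = 1 :> series.
Proof. by rewrite -{1}(rmorph1 (@psV int)) psVK. Qed.

(** The recurrence of the Chebyshev polynomials at [tau ^ 2]. *)
Lemma psU_tau_exp n :
  psU (tau ^+ n.+2) = 2 * tau ^+ 2 * psU (tau ^+ n.+1) - psU (tau ^+ n).
Proof.
have -> : tau ^+ n.+2 = psV (2 * tau ^+ 2) * tau ^+ n.+1 - tau ^+ n.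
  rewrite rmorphM rmorph_nat /= ![tau ^+ n.+1]exprSr mulrCA -tau_quadratic.
  by rewrite !exprSr expr0; ring.
by rewrite raddfB /= psU_V.
Qed.

(** The equation of [tau ^ 2], obtained by squaring that of [tau]. *)
Lemma tau4_quadratic :
  tau ^+ 4 + 1 = (4 * psV (tau ^+ 2) ^+ 2 - 2) * tau ^+ 2.
Proof.
have := tau_quadratic; set X := psV _ => E.
have -> : tau ^+ 4 + 1 = (tau ^+ 2 + 1) ^+ 2 - 2 * tau ^+ 2 by ring.
by rewrite E; ring.
Qed.

(** [ovgf 2] is 1 modulo 2, and each squaring gains a factor 2 at least. *)
Lemma tau_mod4 : exists z, tau = 1 + 4 * z.
Proof.
have [z E] := ovgf_mod2 2; exists (z + z ^+ 2).
by rewrite /tau E -mulr_natl; ring.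
Qed.

Lemma tau2_mod8 : exists z, tau ^+ 2 = 1 + 8 * z.
Proof. by have [z ->] := tau_mod4; exists (z + 2 * z ^+ 2); ring. Qed.

Lemma tau4_mod16 : exists z, tau ^+ 4 = 1 + 16 * z.
Proof.
have [z E] := tau2_mod8; exists (z + 4 * z ^+ 2).
by rewrite (exprM tau 2 2) E; ring.
Qed.

Lemma ovgf_pow2 a :
  ovgf (2 ^ a.+1) ^+ 2 = tau * psV (ovgf (2 ^ a) ^+ 2).
Proof.
by rewrite expnS mul2n ovgf_double ?expn_gt0 // exprMn rmorphXn.
Qed.

End Tau.

(** * Integer spans of families of power series *)

Section Span.
Local Open Scope ring_scope.
Implicit Types (e : nat -> series) (f g h : series).

Inductive zspan e : series -> Prop :=
| zspan_zero : zspan e 0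
| zspan_add n f : zspan e f -> zspan e (f + e n)
| zspan_sub n f : zspan e f -> zspan e (f - e n).

Lemma zspan_gen e n : zspan e (e n).
Proof. by rewrite -[e n]add0r; apply/zspan_add/zspan_zero. Qed.

Lemma zspanD e f g : zspan e f -> zspan e g -> zspan e (f + g).
Proof.
move=> Ef; elim=> [|n h _ IH|n h _ IH]; rewrite ?addr0 ?addrA //.
  exact: zspan_add.
exact: zspan_sub.
Qed.

Lemma zspanN e f : zspan e f -> zspan e (- f).
Proof.
elim=> [|n h _ IH|n h _ IH]; rewrite ?oppr0 ?opprD ?opprK.
- exact: zspan_zero.
- exact: zspan_sub.
- exact: zspan_add.
Qed.

Lemma zspanB e f g : zspan e f -> zspan e g -> zspan e (f - g).
Proof. by move=> Ef /zspanN; apply: zspanD. Qed.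

Lemma zspan_nat e k f : zspan e f -> zspan e (k%:R * f).
Proof.
move=> Ef; rewrite mulr_natl; elim: k => [|k IH]; first exact: zspan_zero.
by rewrite mulrS; apply: zspanD.
Qed.

(** [P] stands for a subgroup of the power series. *)
Lemma zspan_map e (P : series -> Prop) (F : {additive series -> series}) f :
  P 0 -> (forall g h, P g -> P h -> P (g + h)) -> (forall g, P g -> P (- g)) ->
  (forall n, P (F (e n))) -> zspan e f -> P (F f).
Proof.
move=> P0 PD PN Pe; elim=> [|n g _ IH|n g _ IH]; first by rewrite raddf0.
  by rewrite raddfD; apply: PD.
by rewrite raddfB; apply/PD/PN.
Qed.

Lemma zspan_mul e d a f :
  (forall n, zspan d (a * e n)) -> zspan e f -> zspan d (a * f).
Proof.
move=> H; apply: (@zspan_map e _ (a \*o idfun)) => //.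
- exact: zspan_zero.
- exact: zspanD.
- exact: zspanN.
Qed.

End Span.

(** * The descent *)

Section Descent.
Local Open Scope ring_scope.
Implicit Types f g h : series.

(** The ring [Z[tau ^ 2]], as an additive group. *)
Definition in_ztau2 := zspan (fun i => tau ^+ 2 ^+ i).

Lemma ztau2M f : in_ztau2 f -> in_ztau2 (tau ^+ 2 * f).
Proof.
by apply: zspan_mul => n; rewrite -exprS; apply: (zspan_gen _ n.+1).
Qed.

Lemma psU_tau_exp_in n : in_ztau2 (psU (tau ^+ n)).
Proof.
suff: in_ztau2 (psU (tau ^+ n)) /\ in_ztau2 (psU (tau ^+ n.+1)) by case.
elim: n => [|n [IH0 IH1]].
  split; first by rewrite expr0 psU1; apply: (zspan_gen _ 0).
  by rewrite expr1 psU_tau; apply: (zspan_gen _ 1).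
split=> //; rewrite psU_tau_exp; apply: zspanB => //.
by rewrite -mulrA; apply/zspan_nat/ztau2M.
Qed.

Lemma ztau2_psU f : in_ztau2 f -> in_ztau2 (psU (tau * f)).
Proof.
apply: (@zspan_map _ _ (@psU int \o (tau \*o idfun))).
- exact: zspan_zero.
- exact: zspanD.
- exact: zspanN.
by move=> n /=; rewrite -exprM -exprS; apply: psU_tau_exp_in.
Qed.

(** Each application of [U] removes the factor [tau (q)] of
    [ovgf (2 ^ a) ^+ 2]: it is absorbed into [f], and the remaining factors are
    series in [q ^ 2]. *)
Lemma ovgf_pow2_descent a f :
  in_ztau2 f -> in_ztau2 (iter a (@psU int) (f * ovgf (2 ^ a) ^+ 2)).
Proof.
elim: a f => [|a IH] f Hf; first by rewrite expn0 ovgf1 expr1n mulr1.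
rewrite iterSr ovgf_pow2 mulrA mulrC psU_V mulrC; apply: IH.
by rewrite mulrC; apply: ztau2_psU.
Qed.

Lemma ztau2_mod8 f : in_ztau2 f -> exists c : int, exists h, f = c%:~R + 8 * h.
Proof.
have [z E] := tau2_mod8.
pose P f := exists c : int, exists h, f = c%:~R + 8 * h.
apply: (@zspan_map _ P idfun).
- by exists 0, 0; rewrite mulr0 addr0.
- move=> _ _ [c [g ->]] [d [h ->]]; exists (c + d), (g + h).
  by rewrite rmorphD /= mulrDr addrACA.
- move=> _ [c [g ->]]; exists (- c), (- g).
  by rewrite rmorphN /= mulrN opprD.
elim=> [|n [c [h IH]]] /=; first by exists 1, 0; rewrite mulr0 addr0.
exists c, (h + z * tau ^+ 2 ^+ n); rewrite exprS {1}E mulrDl mul1r.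
by rewrite {1}[tau ^+ 2 ^+ n]IH /= mulrDr -!mulrA addrA.
Qed.

Section Lattice.
Variables (v : series) (tau4 : tau ^+ 4 = 1 + 16 * v).

Let w := v + 16 * v ^+ 2.

Lemma tau2_step n : tau ^+ 2 ^+ n.+2 =
  psV (2 + 64 * v) * tau ^+ 2 ^+ n.+1 - tau ^+ 2 ^+ n.
Proof.
have -> : 2 + 64 * v = 4 * tau ^+ 4 - 2 by rewrite tau4; ring.
rewrite rmorphB rmorphM !rmorph_nat /= (exprM tau 2 2) rmorphXn /=.
have := tau4_quadratic; set X := psV _ => E.
have -> : tau ^+ 2 ^+ n.+2 = (tau ^+ 4 + 1) * tau ^+ 2 ^+ n - tau ^+ 2 ^+ n.
  by rewrite mulrDl mul1r addrK (exprM tau 2 2) -exprD.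
by rewrite E [tau ^+ 2 ^+ n.+1]exprS mulrA.
Qed.

Lemma psU_tau2 : psU (tau ^+ 2) = 1 + 32 * v.
Proof.
rewrite psU_tau_exp psU_tau expr0 psU1.
have -> : 2 * tau ^+ 2 * tau ^+ 2 - 1 = 2 * tau ^+ 4 - 1 by ring.
by rewrite tau4; ring.
Qed.

Lemma psU_v : psU v = 8 * w.
Proof.
apply: (@ps_natI 16) => //; rewrite -psU_nat.
have -> : 16 * v = psV (4 * tau ^+ 4 - 2) * tau ^+ 2 - 2 * 1.
  have <- : tau ^+ 4 - 1 = 16 * v by rewrite tau4; ring.
  rewrite rmorphB rmorphM !rmorph_nat /= (exprM tau 2 2) rmorphXn /=.
  by rewrite -tau4_quadratic; ring.
rewrite raddfB /= psU_V psU_nat psU1 psU_tau2 tau4 /w; ring.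
Qed.

(** The other root is [v (- q) = - v / (1 + 16 * v)], since
    [tau (- q) = 1 / tau]. *)
Lemma v_quadratic : v ^+ 2 = 16 * psV w * v + psV w.
Proof.
apply: (@ps_natI 256) => //.
have := tau4_quadratic; set X := psV _ => E.
have w16 : 16 * psV w = X ^+ 4 - X ^+ 2.
  have -> : 16 * psV w = psV (16 * w) by rewrite rmorphM rmorph_nat.
  have -> : 16 * w = tau ^+ 2 ^+ 4 - tau ^+ 2 ^+ 2.
    transitivity (tau ^+ 4 * (tau ^+ 4 - 1)); last by ring.
    by rewrite tau4 /w; ring.
  by rewrite rmorphB /X !rmorphXn.
have -> : 256 * (16 * psV w * v + psV w) = 16 * (16 * psV w) * (1 + 16 * v).
  by ring.
rewrite w16 -tau4.
have -> : 256 * v ^+ 2 = (16 * v) ^+ 2 by ring.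
have -> : 16 * v = tau ^+ 4 + 1 - 2 by rewrite tau4; ring.
have -> : (tau ^+ 4 + 1 - 2) ^+ 2 = (tau ^+ 4 + 1) ^+ 2 - 4 * tau ^+ 4 by ring.
rewrite E; ring.
Qed.

Lemma psU_v_exp n :
  psU (v ^+ n.+2) = 16 * (w * psU (v ^+ n.+1)) + w * psU (v ^+ n).
Proof.
have -> : v ^+ n.+2 = 16 * (psV w * v ^+ n.+1) + psV w * v ^+ n.
  have -> : v ^+ n.+2 = v ^+ 2 * v ^+ n by rewrite -exprD.
  by rewrite v_quadratic exprS; ring.
by rewrite raddfD /= psU_nat !psU_V.
Qed.

(** The lattice [v * Z[8 * v]].  The powers of 8 are needed for [lattice_psU]:
    the coefficient of [v] in [U (v ^ 2)] is 1. *)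
Definition lattice := zspan (fun i => 8 ^+ i * v ^+ i.+1).

Lemma lattice_v : lattice v.
Proof.
by have := zspan_gen (fun i => 8 ^+ i * v ^+ i.+1) 0; rewrite expr0 mul1r.
Qed.

Lemma lattice_8v f : lattice f -> lattice (8 * v * f).
Proof.
apply: zspan_mul => n.
have -> : 8 * v * (8 ^+ n * v ^+ n.+1) = 8 ^+ n.+1 * v ^+ n.+2.
  by rewrite !exprS; ring.
exact: (zspan_gen (fun i => 8 ^+ i * v ^+ i.+1)).
Qed.

Lemma lattice_w : lattice w.
Proof.
have -> : w = v + 2 * (8 * v * v) by rewrite /w; ring.
by apply/(zspanD lattice_v)/zspan_nat/lattice_8v/lattice_v.
Qed.

Lemma lattice_8w f : lattice f -> lattice (8 * w * f).
Proof.
move=> Hf; have -> : 8 * w * f = 8 * v * f + 2 * (8 * v * (8 * v * f)).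
  by rewrite /w; ring.
apply: zspanD; first exact: lattice_8v.
exact/zspan_nat/lattice_8v/lattice_8v.
Qed.

Definition in_8lattice f := exists2 g, lattice g & f = 8 * g.

(** By [psU_v_exp], the generator of index [n + 2] is mapped to
    [128 * w * a + 64 * w * b], where [a] and [b] are the images of the two
    preceding ones, and [8 * w] preserves the lattice. *)
Lemma lattice_psU f : lattice f -> in_8lattice (psU f).
Proof.
have step n : in_8lattice (psU (8 ^+ n * v ^+ n.+1)) /\
    in_8lattice (psU (8 ^+ n.+1 * v ^+ n.+2)).
  have scale i f' : psU (8 ^+ i * f') = 8 ^+ i * psU f'.
    by rewrite -natrX psU_nat.
  elim: n => [|n [[g0 Hg0 IH0] [g1 Hg1 IH1]]].
    split.
      by exists w; rewrite ?expr0 ?mul1r ?expr1 ?psU_v //; apply: lattice_w.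
    exists (w + 16 * (8 * w * w)).
      by apply/(zspanD lattice_w)/zspan_nat/lattice_8w/lattice_w.
    by rewrite expr1 psU_nat psU_v_exp expr1 expr0 psU1 psU_v; ring.
  split; first by exists g1.
  exists (16 * (8 * w * g1) + 8 * (8 * w * g0)).
    by apply: zspanD; apply/zspan_nat/lattice_8w.
  rewrite scale in IH0; rewrite scale in IH1; rewrite scale psU_v_exp.
  transitivity (128 * w * (8 ^+ n.+1 * psU (v ^+ n.+2)) +
                64 * w * (8 ^+ n * psU (v ^+ n.+1))).
    by rewrite !exprS; ring.
  by rewrite IH0 IH1; ring.
apply: (@zspan_map _ _ (@psU int)).
- by exists 0; rewrite ?mulr0 //; apply: zspan_zero.
- move=> _ _ [g Hg ->] [h Hh ->]; exists (g + h); last by rewrite mulrDr.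
  exact: zspanD.
- by move=> _ [g Hg ->]; exists (- g); rewrite ?mulrN //; apply: zspanN.
by move=> n; case: (step n).
Qed.

Lemma lattice_iter_psU b f : lattice f ->
  exists2 g, lattice g & iter b (@psU int) f = 8 ^+ b * g.
Proof.
elim: b f => [|b IH] f Hf; first by exists f; rewrite // expr0 mul1r.
rewrite iterSr; have [g Hg ->] := lattice_psU Hf.
have -> : iter b (@psU int) (8 * g) = 8 * iter b (@psU int) g.
  by elim: b {IH} => //= b ->; rewrite psU_nat.
have [h Hh ->] := IH _ Hg; exists h => //.
by rewrite exprS mulrA.
Qed.

(** The constants are removed from the recurrence [tau2_step]: with
    [U (tau ^ (2 * n)) = 1 + 32 * g_n], it reads
    [g_(n + 2) = 2 * g_(n + 1) - g_n + 2 * v + 64 * v * g_(n + 1)]. *)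
Lemma ztau2_lattice f : in_ztau2 f ->
  exists c : int, exists2 g, lattice g & psU f = c%:~R + 32 * g.
Proof.
pose P f := exists c : int, exists2 g, lattice g & f = c%:~R + 32 * g.
apply: (@zspan_map _ P (@psU int)).
- by exists 0, 0; rewrite ?mulr0 ?addr0 //; apply: zspan_zero.
- move=> _ _ [c [g Hg ->]] [d [h Hh ->]]; exists (c + d), (g + h).
    exact: zspanD.
  by rewrite rmorphD /= mulrDr addrACA.
- move=> _ [c [g Hg ->]]; exists (- c), (- g); first exact: zspanN.
  by rewrite rmorphN /= mulrN opprD.
move=> n; exists 1; rewrite rmorph1.
pose P1 n := exists2 g, lattice g & psU (tau ^+ 2 ^+ n) = 1 + 32 * g.
suff: P1 n /\ P1 n.+1 by case.
elim: n => [|n [[g0 Hg0 E0] [g1 Hg1 E1]]].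
  split.
    exists 0; first exact: zspan_zero.
    by rewrite expr0 psU1 mulr0 addr0.
  by exists v; [exact: lattice_v|rewrite expr1 psU_tau2].
split; first by exists g1.
exists (2 * g1 - g0 + 2 * v + 8 * (8 * v * g1)).
  apply: zspanD; last exact/zspan_nat/lattice_8v.
  apply: zspanD; last exact/zspan_nat/lattice_v.
  by apply: zspanB => //; apply: zspan_nat.
rewrite tau2_step raddfB /= psU_V E0 E1; ring.
Qed.

End Lattice.

Lemma coef_iter_psU a n f :
  coef n (iter a (@psU int) f) = coef (2 ^ a * n)%N f.
Proof.
elim: a n => [|a IH] n; first by rewrite mul1n.
by rewrite coef_U IH expnSr -mulnA mul2n.
Qed.

Lemma psU_int (c : int) : psU c%:~R = c%:~R :> series.
Proof. by rewrite -{1}(rmorph_int (@psV int)) psVK. Qed.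

Lemma coefS_const (c : int) n : coef n.+1 (c%:~R : series) = 0.
Proof. by rewrite raddfMz /= coef_ps1 mul0rz. Qed.

End Descent.

Theorem theorem1p1 (n alpha beta : nat) (alpha_ge1 : 1 <= alpha) :
  Bbar (2 ^ alpha) (2 ^ alpha * (n + 1)) = 0 %[mod 2 ^ 3]
  /\ Bbar (2 ^ alpha) (2 ^ (alpha + beta + 1) * (n + 1))
       = 0 %[mod 2 ^ (3 * beta + 5)].
Proof.
have dvdB k m d (h : series) :
    (Bbar k m)%:R%R = coef n.+1 (d%:R * h)%R -> Bbar k m = 0 %[mod d].
  rewrite mulr_natl raddfMn /= -mulr_natl => E.
  apply/eqP; rewrite mod0n; apply/dvdnP; exists `|coef n.+1 h|.
  by move: E; nia.
rewrite addn1; set F := (ovgf (2 ^ alpha) ^+ 2)%R.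
have F_in : in_ztau2 (iter alpha (@psU int) F).
  rewrite -[F]mul1r; apply: ovgf_pow2_descent.
  exact: (zspan_gen _ 0).
split.
  have [c [h E]] := ztau2_mod8 F_in; apply: (dvdB _ _ _ h).
  by rewrite Bbar_gf -/F -coef_iter_psU E coef_psD coefS_const add0r.
have [v tau4] := tau4_mod16.
have [c [g Hg E]] := ztau2_lattice tau4 F_in.
have [h _ Eh] := lattice_iter_psU tau4 beta Hg.
apply: (dvdB _ _ _ h); rewrite Bbar_gf -/F.
have -> : alpha + beta + 1 = beta + alpha.+1 by lia.
rewrite -coef_iter_psU iterD iterS E.
have -> : (iter beta (@psU int) (c%:~R + 32 * g) =
    c%:~R + 32 * (8 ^+ beta * h))%R.
  rewrite -Eh; elim: beta {h Eh} => //= b ->.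
  by rewrite raddfD /= psU_nat psU_int.
rewrite coef_psD coefS_const add0r; congr (coef _ _).
by rewrite mulrA -natrX -natrM; congr (_%:R * _)%R; rewrite expnD expnM mulnC.
Qed.
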